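(* Let $\mathcal{C}$ be a finitely complete, finitely co-complete category, equipped with a model structure which is a Bousfield localization or a Bousfield colocalization of the discrete model structure on $\mathcal{C}$. Suppose furthermore that $\mathcal{C}$ is pointed, so that the model structure defines the structure of a Waldhausen category on the full subcategory of $\mathcal{C}$ generated by the cofibrant objects. Then the Waldhausen $K$-theory of $\mathcal{C}$ (i.e. of this Waldhausen category) is trivial, that is, \[ K_*(\mathcal{C}) = \pi_*\left(\Omega\left|wS_{\bullet}\mathcal{C}\right|\right)\cong 0. \]
   Context: A model category is a finitely complete, finitely co-complete category with three classes of morphisms closed under retracts (cofibrations, weak equivalences, fibrations) such that: each morphism factors as an acyclic cofibration followed by a fibration, and as a cofibration followed by an acyclic fibration; weak equivalences have the two-out-of-three property; the cofibrations are precisely the maps with the left lifting property with respect to acyclic fibrations; the acyclic cofibrations are precisely the maps with the left lifting property with respect to the fibrations. (''Acyclic'' means also a weak equivalence.) All limits and colimits are not assumed to exist, factorizations are not part of the structure, and factorizations are not assumed functorial. An object is cofibrant if the map from the initial object to it is a cofibration. The discrete model structure: all maps are cofibrations and fibrations, and the weak equivalences are the isomorphisms. A Bousfield localization (respectively Bousfield colocalization) of a model category $\mathcal{M}$ is a model category $\mathcal{M}'$ with the same underlying category, the same cofibrations (respectively the same fibrations), and whose collection of weak equivalences contains that of $\mathcal{M}$. Pointed means that the initial and terminal objects are isomorphic. The Waldhausen category structure on the full subcategory of cofibrant objects has as its cofibrations and weak equivalences those of the model structure. $wS_\bullet$ denotes Waldhausen's $S_\bullet$-construction with respect to the weak equivalences,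 applied to this Waldhausen category, and $|\cdot|$ is geometric realization. *)

(* Defs.v *)
From HB Require Import structures.
From mathcomp Require Import all_boot all_order all_algebra generic_quotient.
From mathcomp Require Import all_classical all_reals topology homotopy.
From Stdlib Require Import Relations.

Set Implicit Arguments.
Unset Strict Implicit.
Unset Printing Implicit Defensive.
Import Order.TTheory GRing.Theory Num.Theory.
Import numFieldTopology.Exports.
Local Open Scope classical_set_scope.
Local Open Scope ring_scope.
Local Open Scope quotient_scope.

Reserved Notation "g '\oc' f" (at level 40, left associativity).

#[projections(primitive)]
Record category := Category {
  obj :> Type;
  hom : obj -> obj -> Type;
  idm : forall a, hom a a;
  compm : forall a b c, hom b c -> hom a b -> hom a c;
  comp1m : forall a b (f : hom a b), compm (idm b) f = f;
  compm1 : forall a b (f : hom a b), compm f (idm a) = f;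
  compmA : forall a b c d (h : hom c d) (g : hom b c) (f : hom a b),
    compm h (compm g f) = compm (compm h g) f }.

Arguments hom {c} a b : rename.
Arguments idm {c} a : rename.
Arguments compm {c} [a b c] g f : rename.
Notation "g \oc f" := (compm g f).

#[projections(primitive)]
Record functor (C D : category) := Functor {
  fobj :> C -> D;
  fmap : forall a b, hom a b -> hom (fobj a) (fobj b);
  fmap_id : forall a, fmap (idm a) = idm (fobj a);
  fmap_comp : forall a b c (g : hom b c) (f : hom a b),
    fmap (g \oc f) = fmap g \oc fmap f }.

Arguments fmap {C D} F [a b] f : rename.

Definition functor_comp (B C D : category) (G : functor C D) (F : functor B C) :
  functor B D.
Proof.
refine (@Functor B D (fun a => G (F a)) (fun a b f => fmap G (fmap F f)) _ _).
- by move=> a; rewrite !fmap_id.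
- by move=> a b c g f; rewrite !fmap_comp.
Defined.

Definition opposite (C : category) : category :=
  @Category C (fun a b => hom b a) (fun a => idm a)
    (fun a b c g f => f \oc g)
    (fun a b f => compm1 f) (fun a b f => comp1m f)
    (fun a b c d h g f => esym (compmA f g h)).

Definition full_subcategory (C : category) (P : C -> Prop) : category :=
  @Category {x : C | P x} (fun x y => hom (sval x) (sval y))
    (fun x => idm (sval x)) (fun x y z g f => g \oc f)
    (fun x y f => comp1m f) (fun x y f => compm1 f)
    (fun x y z t h g f => compmA h g f).

Definition preorder_category (T : Type) (le : T -> T -> Prop)
    (le_refl : forall x, le x x)
    (le_trans : forall x y z, le x y -> le y z -> le x z) : category :=
  @Category T le le_refl (fun x y z yz xy => le_trans x y z xy yz)
    (fun x y f => Prop_irrelevance _ _) (fun x y f => Prop_irrelevance _ _)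
    (fun x y z t h g f => Prop_irrelevance _ _).

Lemma preorder_hom_eq (T : Type) (le : T -> T -> Prop)
    (le_refl : forall x, le x x)
    (le_trans : forall x y z, le x y -> le y z -> le x z)
    (x y : preorder_category le_refl le_trans) (f g : hom x y) : f = g.
Proof. exact: (@Prop_irrelevance (le x y)). Qed.

Section Limits.
Variable C : category.

Definition is_initial (a : C) := forall b, exists! f : hom a b, True.
Definition is_terminal (a : C) := forall b, exists! f : hom b a, True.

Definition is_iso (a b : C) (f : hom a b) :=
  exists g : hom b a, g \oc f = idm a /\ f \oc g = idm b.

Definition isomorphic (a b : C) := exists f : hom a b, is_iso f.

Definition pointed_category := forall i t : C,
  is_initial i -> is_terminal t -> isomorphic i t.

Record cone (J : category) (F : functor J C) := Cone {
  apex : C;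
  leg : forall j, hom apex (F j);
  leg_natural : forall j k (f : hom j k), fmap F f \oc leg j = leg k }.

Definition is_limit (J : category) (F : functor J C) (c : cone F) :=
  forall c' : cone F, exists! h : hom (apex c') (apex c),
    forall j, leg c j \oc h = leg c' j.

(* f' is the cobase change of f along g:
      a --f--> b
      |g       |g'
      c --f'-> d  *)
Definition is_pushout (a b c d : C) (f : hom a b) (g : hom a c)
    (f' : hom c d) (g' : hom b d) :=
  g' \oc f = f' \oc g /\
  forall (e : C) (u : hom b e) (v : hom c e), u \oc f = v \oc g ->
    exists! h : hom d e, h \oc g' = u /\ h \oc f' = v.

Lemma id_pushout (a : C) : is_pushout (idm a) (idm a) (idm a) (idm a).
Proof.
split=> // e u v; rewrite !compm1 => uv; exists u; split.
- by rewrite compm1.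
- by move=> h [<- _]; rewrite compm1.
Qed.

Definition lifts (a b x y : C) (i : hom a b) (p : hom x y) :=
  forall (u : hom a x) (v : hom b y), p \oc u = v \oc i ->
    exists h : hom b x, h \oc i = u /\ p \oc h = v.

Definition retract_of (a b c d : C) (f : hom a b) (g : hom c d) :=
  exists (s : hom a c) (r : hom c a) (s' : hom b d) (r' : hom d b),
    [/\ r \oc s = idm a, r' \oc s' = idm b,
        g \oc s = s' \oc f & f \oc r = r' \oc g].

Definition map_class := forall a b : C, hom a b -> Prop.

Definition retract_closed (W : map_class) :=
  forall (a b c d : C) (f : hom a b) (g : hom c d),
    retract_of f g -> W c d g -> W a b f.

Definition two_of_three (W : map_class) :=
  forall (a b c : C) (f : hom a b) (g : hom b c),
    [/\ W a b f -> W b c g -> W a c (g \oc f),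
        W a b f -> W a c (g \oc f) -> W b c g &
        W b c g -> W a c (g \oc f) -> W a b f].

End Limits.

Definition finite_category (J : category) :=
  finite_set [set: J] /\ forall i j : J, finite_set [set: hom i j].

Definition finitely_complete (C : category) :=
  forall J : category, finite_category J ->
  forall F : functor J C, exists c : cone F, is_limit c.

Definition finitely_cocomplete (C : category) :=
  finitely_complete (opposite C).

Record model_structure (C : category) := ModelStructure {
  cof : map_class C;
  weq : map_class C;
  fib : map_class C;
  cof_retract : retract_closed cof;
  weq_retract : retract_closed weq;
  fib_retract : retract_closed fib;
  factor_acof_fib : forall (a b : C) (f : hom a b),
    exists (c : C) (i : hom a c) (p : hom c b),
      [/\ p \oc i = f, cof i, weq i & fib p];
  factor_cof_afib : forall (a b : C) (f : hom a b),
    exists (c : C) (i : hom a c) (p : hom c b),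
      [/\ p \oc i = f, cof i, fib p & weq p];
  weq_two_of_three : two_of_three weq;
  cofP : forall (a b : C) (f : hom a b), cof f <->
    forall (x y : C) (p : hom x y), fib p -> weq p -> lifts f p;
  acofP : forall (a b : C) (f : hom a b), cof f /\ weq f <->
    forall (x y : C) (p : hom x y), fib p -> lifts f p }.

Arguments cof {C} m [a b] f : rename.
Arguments weq {C} m [a b] f : rename.
Arguments fib {C} m [a b] f : rename.

Section DiscreteModel.
Variable C : category.

Lemma iso_retract : retract_closed (@is_iso C).
Proof.
move=> a b c d f g [s [r [s' [r' [rs r's' gs fr]]]]] [k [kg gk]].
exists (r \oc k \oc s'); split.
- by rewrite -compmA -gs compmA -(compmA r k g) kg compm1 rs.
- by rewrite compmA (compmA f) fr -(compmA r' g k) gk compm1 r's'.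
Qed.

Lemma iso_id (a : C) : is_iso (idm a).
Proof. by exists (idm a); rewrite comp1m. Qed.

Lemma iso_two_of_three : two_of_three (@is_iso C).
Proof.
move=> a b c f g; split.
- move=> [f' [f'f ff']] [g' [g'g gg']]; exists (f' \oc g'); split.
  + by rewrite compmA -(compmA f') g'g compm1.
  + by rewrite compmA -(compmA g) ff' compm1.
- move=> [f' [f'f ff']] [k [kgf gfk]]; exists (f \oc k); split.
  + have: k \oc g = f' by rewrite -[k \oc g]compm1 -ff' compmA -(compmA k) kgf comp1m.
    by rewrite -compmA => ->.
  + by rewrite compmA.
- move=> [g' [g'g gg']] [k [kgf gfk]]; exists (k \oc g); split.
  + by rewrite -compmA.
  + have: f \oc k = g' by rewrite -[f \oc k]comp1m -g'g -compmA (compmA g f) gfk compm1.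
    by rewrite compmA => ->.
Qed.

Lemma iso_lifts (a b x y : C) (f : hom a b) (p : hom x y) :
  is_iso p -> lifts f p.
Proof.
move=> [q [qp pq]] u v e; exists (q \oc v); split.
- by rewrite -compmA -e compmA qp comp1m.
- by rewrite compmA pq comp1m.
Qed.

Lemma iso_liftsP (a b : C) (f : hom a b) :
  is_iso f <-> forall (x y : C) (p : hom x y), lifts f p.
Proof.
split.
- move=> [g [gf fg]] x y p u v e; exists (u \oc g); split.
  + by rewrite -compmA gf compm1.
  + by rewrite compmA e -compmA fg compm1.
- move=> /(_ _ _ f (idm a) (idm b)); rewrite compm1 comp1m.
  by case=> // h [hf fh]; exists h.
Qed.

Definition discrete_model : model_structure C.
Proof.
refine (@ModelStructure C (fun _ _ _ => True) (@is_iso C) (fun _ _ _ => True)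
  _ iso_retract _ _ _ iso_two_of_three _ _) => //.
- by move=> a b f; exists a, (idm a), f; split; rewrite ?compm1 //; exact: iso_id.
- by move=> a b f; exists b, f, (idm b); split; rewrite ?comp1m //; exact: iso_id.
- by move=> a b f; split=> // _ x y p _; exact: iso_lifts.
- move=> a b f; split; first by move=> [_ /iso_liftsP l] x y p _; exact: l.
  by move=> l; split=> //; apply/iso_liftsP => x y p; exact: l.
Defined.

End DiscreteModel.

Definition bousfield_localization (C : category) (M M' : model_structure C) :=
  (forall (a b : C) (f : hom a b), cof M' f <-> cof M f) /\
  (forall (a b : C) (f : hom a b), weq M f -> weq M' f).

Definition bousfield_colocalization (C : category) (M M' : model_structure C) :=
  (forall (a b : C) (f : hom a b), fib M' f <-> fib M f) /\
  (forall (a b : C) (f : hom a b), weq M f -> weq M' f).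

Definition cofibrant (C : category) (M : model_structure C) (x : C) :=
  forall (i : C) (f : hom i x), is_initial i -> cof M f.

Lemma initial_cofibrant (C : category) (M : model_structure C) (z : C) :
  is_initial z -> cofibrant M z.
Proof.
move=> z0 i f i0; apply/cofP => x y p _ _ u v e.
have [h _] := z0 x; exists h; split.
- by have [k [_ ku]] := i0 x; rewrite -(ku (h \oc f) I) -(ku u I).
- by have [k [_ ku]] := z0 y; rewrite -(ku (p \oc h) I) -(ku v I).
Qed.

Record waldhausen_data := WaldhausenData {
  wcat :> category;
  wzero : wcat;
  wcof : map_class wcat;
  wweq : map_class wcat }.

Arguments wzero : clear implicits.
Arguments wcof W [a b] f : rename.
Arguments wweq W [a b] f : rename.

Record is_waldhausen (W : waldhausen_data) : Prop := IsWaldhausen {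
  wzero_initial : is_initial (wzero W);
  wzero_terminal : is_terminal (wzero W);
  wcof_iso : forall (a b : W) (f : hom a b), is_iso f -> wcof W f;
  wcof_comp : forall (a b c : W) (g : hom b c) (f : hom a b),
    wcof W g -> wcof W f -> wcof W (g \oc f);
  wcof_zero : forall (a : W) (f : hom (wzero W) a), wcof W f;
  wcof_pushout_ex : forall (a b c : W) (f : hom a b) (g : hom a c),
    wcof W f -> exists (d : W) (f' : hom c d) (g' : hom b d),
      is_pushout f g f' g';
  wcof_pushout : forall (a b c d : W) (f : hom a b) (g : hom a c)
      (f' : hom c d) (g' : hom b d),
    wcof W f -> is_pushout f g f' g' -> wcof W f';
  wweq_iso : forall (a b : W) (f : hom a b), is_iso f -> wweq W f;
  wweq_comp : forall (a b c : W) (g : hom b c) (f : hom a b),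
    wweq W g -> wweq W f -> wweq W (g \oc f);
  wweq_gluing : forall (a b c d a' b' c' d' : W)
      (f : hom a b) (g : hom a c) (h : hom c d) (k : hom b d)
      (f' : hom a' b') (g' : hom a' c') (h' : hom c' d') (k' : hom b' d')
      (u : hom a a') (v : hom b b') (w : hom c c') (t : hom d d'),
    wcof W f -> is_pushout f g h k ->
    wcof W f' -> is_pushout f' g' h' k' ->
    wweq W u -> wweq W v -> wweq W w ->
    v \oc f = f' \oc u -> w \oc g = g' \oc u ->
    t \oc h = h' \oc w -> t \oc k = k' \oc v -> wweq W t }.

Record waldhausen_category := WaldhausenCategory {
  wdata :> waldhausen_data;
  wP : is_waldhausen wdata }.

Definition cofibrant_objects (C : category) (M : model_structure C) (z : C)
    (z0 : is_initial z) : waldhausen_data :=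
  @WaldhausenData (full_subcategory (cofibrant M))
    (exist _ z (initial_cofibrant M z0))
    (fun x y f => cof M f) (fun x y f => weq M f).

(* morphisms [p] -> [q] of the simplex category *)
#[projections(primitive)]
Record simplex_map (p q : nat) := SimplexMap {
  smap :> 'I_p.+1 -> 'I_q.+1;
  smap_le : forall i j : 'I_p.+1, (i <= j)%N -> (smap i <= smap j)%N }.

Definition simplex_id p : simplex_map p p :=
  @SimplexMap p p id (fun i j ij => ij).

Definition simplex_comp p q r (g : simplex_map q r) (f : simplex_map p q) :
  simplex_map p r :=
  @SimplexMap p r (fun i => g (f i)) (fun i j ij => smap_le g (smap_le f ij)).

Record bisimplicial_set := BisimplicialSet {
  cell :> nat -> nat -> Type;
  face : forall p p' q q', simplex_map p' p -> simplex_map q' q ->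
    cell p q -> cell p' q';
  face_id : forall p q (x : cell p q), face (simplex_id p) (simplex_id q) x = x;
  face_comp : forall p p' p'' q q' q''
      (th : simplex_map p' p) (th' : simplex_map p'' p')
      (ph : simplex_map q' q) (ph' : simplex_map q'' q') (x : cell p q),
    face (simplex_comp th th') (simplex_comp ph ph') x
    = face th' ph' (face th ph x) }.

Arguments face {B p p' q q'} th ph x : rename.

(* the poset [p], whose functors to D are the p-simplices of the nerve of D *)
Definition ord_category (p : nat) : category :=
  @preorder_category 'I_p.+1 (fun i j => (i <= j)%N)
    (fun i => leqnn i) (fun i j k => @leq_trans j i k).

Definition ord_map p q (f : simplex_map p q) :
  functor (ord_category p) (ord_category q).
Proof.
refine (@Functor (ord_category p) (ord_category q) (smap f) (smap_le f) _ _).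
- by move=> a; exact: preorder_hom_eq.
- by move=> a b c g h; exact: preorder_hom_eq.
Defined.

(* the category Ar[q] of arrows of [q] *)
#[projections(primitive)]
Record ar (q : nat) := Ar {
  src : 'I_q.+1;
  tgt : 'I_q.+1;
  src_le_tgt : (src <= tgt)%N }.

Definition ar_le q (x y : ar q) : Prop :=
  (src x <= src y)%N /\ (tgt x <= tgt y)%N.

Lemma ar_le_refl q (x : ar q) : ar_le x x.
Proof. by split. Qed.

Lemma ar_le_trans q (x y z : ar q) : ar_le x y -> ar_le y z -> ar_le x z.
Proof.
move=> [sxy txy] [syz tyz]; split.
- exact: leq_trans sxy syz.
- exact: leq_trans txy tyz.
Qed.

Definition ar_category (q : nat) : category :=
  preorder_category (@ar_le_refl q) (@ar_le_trans q).

Definition ar_map p q (f : simplex_map p q) :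
  functor (ar_category p) (ar_category q).
Proof.
refine (@Functor (ar_category p) (ar_category q)
  (fun x => Ar (smap_le f (src_le_tgt x)))
  (fun x y xy => conj (smap_le f (proj1 xy)) (smap_le f (proj2 xy))) _ _).
- by move=> a; exact: preorder_hom_eq.
- by move=> a b c g h; exact: preorder_hom_eq.
Defined.

Section SConstruction.
Variable W : waldhausen_category.

(* For A : Ar[q] -> W and i <= j <= k, the square
     A_ij --> A_ik
      |        |
     A_jj --> A_jk,   with A_jj the zero object,
   exhibits A_jk as the quotient of A_ik by A_ij. *)
#[projections(primitive)]
Record S_object (q : nat) := SObject {
  S_fun :> functor (ar_category q) W;
  S_diag : forall (i : 'I_q.+1) (ii : (i <= i)%N), S_fun (Ar ii) = wzero W;
  S_cof : forall (i j k : 'I_q.+1) (ij : (i <= j)%N) (ik : (i <= k)%N)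
      (le : @hom (ar_category q) (Ar ij) (Ar ik)),
    wcof W (fmap S_fun le);
  S_quot : forall (i j k : 'I_q.+1)
      (ij : (i <= j)%N) (ik : (i <= k)%N) (jj : (j <= j)%N) (jk : (j <= k)%N)
      (f : @hom (ar_category q) (Ar ij) (Ar ik))
      (g : @hom (ar_category q) (Ar ij) (Ar jj))
      (f' : @hom (ar_category q) (Ar jj) (Ar jk))
      (g' : @hom (ar_category q) (Ar ik) (Ar jk)),
    is_pushout (fmap S_fun f) (fmap S_fun g) (fmap S_fun f') (fmap S_fun g') }.

#[projections(primitive)]
Record S_weq (q : nat) (A B : S_object q) := SWeq {
  S_map :> forall x, hom (A x) (B x);
  S_map_natural : forall (x y : ar_category q) (f : hom x y),
    S_map y \oc fmap A f = fmap B f \oc S_map x;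
  S_map_weq : forall x, wweq W (S_map x) }.

Lemma S_weq_eq q (A B : S_object q) (f g : S_weq A B) :
  (forall x, f x = g x) -> f = g.
Proof.
case: f g => [f fn fw] [g gn gw] /= fg.
have {}fg : f = g by exact: functional_extensionality_dep.
subst g.
by rewrite (Prop_irrelevance fn gn) (Prop_irrelevance fw gw).
Qed.

Definition S_weq_id q (A : S_object q) : S_weq A A.
Proof.
refine (@SWeq q A A (fun x => idm (A x)) _ _).
- by move=> x y f; rewrite comp1m compm1.
- by move=> x; apply: (wweq_iso (wP W)); exact: iso_id.
Defined.

Definition S_weq_comp q (A B D : S_object q) (g : S_weq B D) (f : S_weq A B) :
  S_weq A D.
Proof.
refine (@SWeq q A D (fun x => g x \oc f x) _ _).
- by move=> x y h; rewrite -compmA S_map_natural !compmA S_map_natural.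
- by move=> x; apply: (wweq_comp (wP W)); exact: S_map_weq.
Defined.

Definition wS_category (q : nat) : category.
Proof.
refine (@Category (S_object q) (@S_weq q) (@S_weq_id q) (@S_weq_comp q) _ _ _).
- by move=> A B f; apply: S_weq_eq => x /=; rewrite comp1m.
- by move=> A B f; apply: S_weq_eq => x /=; rewrite compm1.
- by move=> A B D E h g f; apply: S_weq_eq => x /=; rewrite compmA.
Defined.

Definition S_restrict_obj p q (f : simplex_map p q) (A : S_object q) :
  S_object p :=
  @SObject p (functor_comp A (ar_map f))
    (fun i ii => S_diag A (smap_le f ii))
    (fun i j k ij ik le => S_cof A (fmap (ar_map f) le))
    (fun i j k ij ik jj jk g h g' h' =>
       S_quot A (fmap (ar_map f) g) (fmap (ar_map f) h)
         (fmap (ar_map f) g') (fmap (ar_map f) h')).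

Definition S_restrict p q (f : simplex_map p q) :
  functor (wS_category q) (wS_category p).
Proof.
refine (@Functor (wS_category q) (wS_category p) (S_restrict_obj f)
  (fun A B g => @SWeq p (S_restrict_obj f A) (S_restrict_obj f B)
    (fun x => g (ar_map f x)) (fun x y h => S_map_natural g (fmap (ar_map f) h))
    (fun x => S_map_weq g (ar_map f x))) _ _).
- by move=> A; exact: S_weq_eq.
- by move=> A B D g h; exact: S_weq_eq.
Defined.

(* (p, q)-cells: p-simplices of the nerve of wS_q *)
Definition wS_cell (p q : nat) := functor (ord_category p) (wS_category q).

Definition wS_face p p' q q' (th : simplex_map p' p) (ph : simplex_map q' q)
    (x : wS_cell p q) : wS_cell p' q' :=
  functor_comp (functor_comp (S_restrict ph) x) (ord_map th).

(* A cell is determined by its underlying families of objects and of maps of W;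
   the remaining fields are propositions. *)
Record raw_cell (p q : nat) := RawCell {
  raw_obj : ord_category p -> ar_category q -> W;
  raw_map : forall a (x y : ar_category q), hom x y ->
    hom (raw_obj a x) (raw_obj a y);
  raw_weq : forall (a b : ord_category p), hom a b -> forall x,
    hom (raw_obj a x) (raw_obj b x) }.

Definition raw p q (x : wS_cell p q) : raw_cell p q :=
  @RawCell p q (fun a => fobj (x a)) (fun a => @fmap _ _ (x a))
    (fun a b f => S_map (fmap x f)).

Arguments raw_map {p q} r a [x y] f.
Arguments raw_weq {p q} r [a b] h x.

Record is_cell p q (r : raw_cell p q) : Prop := IsCell {
  rc_id : forall a x, raw_map r a (idm x) = idm (raw_obj r a x);
  rc_comp : forall a (x y z : ar_category q) (g : hom y z) (f : hom x y),
    raw_map r a (g \oc f) = raw_map r a g \oc raw_map r a f;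
  rc_diag : forall a (i : 'I_q.+1) (ii : (i <= i)%N),
    raw_obj r a (Ar ii) = wzero W;
  rc_cof : forall a (i j k : 'I_q.+1) (ij : (i <= j)%N) (ik : (i <= k)%N)
      (le : @hom (ar_category q) (Ar ij) (Ar ik)),
    wcof W (raw_map r a le);
  rc_quot : forall a (i j k : 'I_q.+1)
      (ij : (i <= j)%N) (ik : (i <= k)%N) (jj : (j <= j)%N) (jk : (j <= k)%N)
      (f : @hom (ar_category q) (Ar ij) (Ar ik))
      (g : @hom (ar_category q) (Ar ij) (Ar jj))
      (f' : @hom (ar_category q) (Ar jj) (Ar jk))
      (g' : @hom (ar_category q) (Ar ik) (Ar jk)),
    is_pushout (raw_map r a f) (raw_map r a g)
      (raw_map r a f') (raw_map r a g');
  rc_natural : forall (a b : ord_category p) (h : hom a b)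
      (x y : ar_category q) (f : hom x y),
    raw_weq r h y \oc raw_map r a f = raw_map r b f \oc raw_weq r h x;
  rc_weq : forall (a b : ord_category p) (h : hom a b) x,
    wweq W (raw_weq r h x);
  rc_weq_id : forall a x, raw_weq r (idm a) x = idm (raw_obj r a x);
  rc_weq_comp : forall (a b c : ord_category p) (k : hom b c) (h : hom a b) x,
    raw_weq r (k \oc h) x = raw_weq r k x \oc raw_weq r h x }.

Definition cook_obj p q (r : raw_cell p q) (ok : is_cell r) a : S_object q :=
  @SObject q (@Functor (ar_category q) W (raw_obj r a) (@raw_map _ _ r a)
      (@rc_id _ _ _ ok a) (@rc_comp _ _ _ ok a))
    (@rc_diag _ _ _ ok a) (@rc_cof _ _ _ ok a) (@rc_quot _ _ _ ok a).

Definition cook p q (r : raw_cell p q) (ok : is_cell r) : wS_cell p q.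
Proof.
refine (@Functor (ord_category p) (wS_category q) (cook_obj ok)
  (fun a b h => @SWeq q (cook_obj ok a) (cook_obj ok b) (@raw_weq _ _ r _ _ h)
     (@rc_natural _ _ _ ok _ _ h) (@rc_weq _ _ _ ok _ _ h)) _ _).
- by move=> a; apply: S_weq_eq; exact: rc_weq_id.
- by move=> a b c k h; apply: S_weq_eq; exact: rc_weq_comp.
Defined.

Lemma raw_is_cell p q (x : wS_cell p q) : is_cell (raw x).
Proof.
exact: (@IsCell p q (raw x) (fun a => @fmap_id _ _ (x a))
  (fun a => @fmap_comp _ _ (x a)) (fun a => @S_diag _ (x a))
  (fun a => @S_cof _ (x a)) (fun a => @S_quot _ (x a))
  (fun a b h => @S_map_natural _ _ _ (fmap x h))
  (fun a b h => @S_map_weq _ _ _ (fmap x h))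
  (fun a u => congr1 (fun w : S_weq (x a) (x a) => w u) (fmap_id x a))
  (fun a b c k h u =>
     congr1 (fun w : S_weq (x a) (x c) => w u) (fmap_comp x k h))).
Defined.

Lemma functor_eqP (C D : category) (o : C -> D)
    (m : forall a b, hom a b -> hom (o a) (o b)) i c i' c' :
  @Functor C D o m i c = @Functor C D o m i' c'.
Proof. by rewrite (Prop_irrelevance i i') (Prop_irrelevance c c'). Qed.

Lemma rawK p q (x : wS_cell p q) : cook (raw_is_cell x) = x.
Proof. exact: functor_eqP. Qed.

Lemma raw_inj p q : injective (@raw p q).
Proof.
move=> x y xy; rewrite -(rawK x) -(rawK y).
move: (raw_is_cell x) (raw_is_cell y); rewrite xy => u v.
by rewrite (Prop_irrelevance u v).
Qed.

Lemma wS_face_id p q (x : wS_cell p q) :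
  wS_face (simplex_id p) (simplex_id q) x = x.
Proof.
apply: raw_inj; rewrite /raw /=; congr RawCell.
do 4 apply: functional_extensionality_dep => ?.
by congr (fmap (x _)); exact: preorder_hom_eq.
Qed.

Lemma wS_face_comp p p' p'' q q' q''
    (th : simplex_map p' p) (th' : simplex_map p'' p')
    (ph : simplex_map q' q) (ph' : simplex_map q'' q') (x : wS_cell p q) :
  wS_face (simplex_comp th th') (simplex_comp ph ph') x
  = wS_face th' ph' (wS_face th ph x).
Proof.
apply: raw_inj; rewrite /raw; congr RawCell.
do 4 apply: functional_extensionality_dep => ?.
by congr (fmap (x _)); exact: preorder_hom_eq.
Qed.

Definition wS : bisimplicial_set :=
  BisimplicialSet wS_face_id wS_face_comp.

Definition S_zero : S_object 0.
Proof.
refine (@SObject 0 (@Functor (ar_category 0) W (fun _ => wzero W)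
  (fun _ _ _ => idm (wzero W)) (fun _ => erefl)
  (fun _ _ _ _ _ => esym (comp1m (idm (wzero W))))) _ _ _).
- by [].
- by move=> *; apply: (wcof_iso (wP W)); exact: iso_id.
- by move=> *; exact: id_pushout.
Defined.

Definition wS_base : wS 0 0 :=
  @Functor (ord_category 0) (wS_category 0) (fun _ => S_zero)
    (fun _ _ _ => idm (S_zero : wS_category 0))
    (fun _ => erefl) (fun _ _ _ _ _ => esym (comp1m _)).

End SConstruction.

Section Realization.
Variables (R : realType) (B : bisimplicial_set).

Definition simplex (n : nat) : set (prod_topology (fun _ : 'I_n.+1 => R)) :=
  [set t | (forall i, 0 <= t i) /\ \sum_i t i = 1].
Arguments simplex n : clear implicits.

(* t is the image of s under the affine map of simplices induced by th *)
Definition simplex_image n m (th : simplex_map n m)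
    (s : set_type (simplex n)) (t : set_type (simplex m)) :=
  forall j, set_val t j = \sum_(i | th i == j) set_val s i.

Definition cell_index := {classic {pq : nat * nat & B pq.1 pq.2}}.

Definition cells :=
  {b : cell_index &
    (set_type (simplex (projT1 b).1) * set_type (simplex (projT1 b).2))%type}.

Definition mk_cell p q (x : B p q) (s : set_type (simplex p))
    (t : set_type (simplex q)) : cells :=
  existT _ (existT _ (p, q) x : cell_index) (s, t).

Inductive glue : cells -> cells -> Prop :=
| Glue p p' q q' (th : simplex_map p' p) (ph : simplex_map q' q) (x : B p q)
    (s : set_type (simplex p')) (s1 : set_type (simplex p))
    (t : set_type (simplex q')) (t1 : set_type (simplex q)) :
    simplex_image th s s1 -> simplex_image ph t t1 ->
    glue (mk_cell (face th ph x) s t) (mk_cell x s1 t1).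

Definition glued (u v : cells) : bool := `[< clos_refl_sym_trans _ glue u v >].

Lemma glued_equiv : equiv_class_of glued.
Proof.
split=> [u|u v|v u w].
- by apply/asboolP; exact: rst_refl.
- by apply/asboolP/asboolP => ?; exact: rst_sym.
- by move=> /asboolP uv /asboolP vw; apply/asboolP; exact: rst_trans uv vw.
Qed.

Definition glued_rel : equiv_rel cells := EquivRelPack glued_equiv.

Definition realization : topologicalType :=
  quotient_topology {eq_quot glued_rel}.

End Realization.

Arguments simplex R n : clear implicits.

Section HomotopyGroups.
Variable R : realType.

Definition unit_interval := set_type `[0 : R, 1]%classic.
HB.instance Definition _ := Topological.on unit_interval.

Lemma zero_in_unit_interval : (0 : R) \in `[0 : R, 1]%classic.
Proof. by rewrite inE /= in_itv /= lexx ler01. Qed.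

Lemma one_in_unit_interval : (1 : R) \in `[0 : R, 1]%classic.
Proof. by rewrite inE /= in_itv /= lexx ler01. Qed.

Definition I0 : unit_interval := exist _ 0 zero_in_unit_interval.
Definition I1 : unit_interval := exist _ 1 one_in_unit_interval.

Lemma I0_neq_I1 : I0 != I1.
Proof. by apply/eqP => /(congr1 val) /= /eqP; rewrite eq_sym oner_eq0. Qed.

HB.instance Definition _ := isBiPointed.Build unit_interval I0_neq_I1.

Section Space.
Variables (X : topologicalType) (x : X).

(* with the compact-open topology *)
Definition loop_space : topologicalType := {path unit_interval from x to x}.

Definition constant_loop : loop_space :=
  cst x : {path unit_interval from x to x}.

Definition cube (n : nat) : topologicalType :=
  prod_topology (fun _ : 'I_n => unit_interval).

Definition cube_boundary n : set (cube n) :=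
  [set c | exists i, c i = I0 \/ c i = I1].

Definition spheroid n :=
  {f : cube n -> X | continuous f /\ forall c, cube_boundary c -> f c = x}.

Definition spheroid_homotopic n (f g : spheroid n) :=
  exists H : cube n * unit_interval -> X,
    [/\ continuous H,
        forall c, H (c, I0) = sval f c,
        forall c, H (c, I1) = sval g c &
        forall c t, cube_boundary c -> H (c, t) = x].

Lemma constant_spheroidP n :
  continuous (cst x : cube n -> X) /\
  forall c, cube_boundary c -> (cst x : cube n -> X) c = x.
Proof. by split=> [c|]; [apply: cst_continuous|]. Qed.

Definition constant_spheroid n : spheroid n :=
  exist _ (cst x) (constant_spheroidP n).

Definition homotopy_class n (f : spheroid n) : set (spheroid n) :=
  [set g | spheroid_homotopic f g].

(* the underlying set of the n-th homotopy group; the class of the constant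
   spheroid is its neutral element, so the group is trivial exactly when that
   class is its only element *)
Definition homotopy_group n : set (set (spheroid n)) :=
  range (@homotopy_class n).

End Space.
End HomotopyGroups.

Arguments loop_space R {X} x.
Arguments constant_loop R {X} x.
Arguments constant_spheroid R {X} x n.
Arguments homotopy_class {R X x n} f.
Arguments homotopy_group R {X} x n.

Section KTheory.
Variables (R : realType) (W : waldhausen_category).

Lemma point_in_simplex0 :
  ((fun _ => 1) : prod_topology (fun _ : 'I_1 => R)) \in simplex R 0.
Proof. by rewrite inE; split=> [i|]; rewrite ?ler01 // big_ord1. Qed.

Definition point_simplex0 : set_type (simplex R 0) :=
  @exist _ (fun t => t \in simplex R 0) _ point_in_simplex0.

Definition K_basepoint : realization R (wS W) :=
  \pi_(realization R (wS W)) (mk_cell (wS_base W) point_simplex0 point_simplex0).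

Definition K_space : topologicalType := loop_space R K_basepoint.

Definition K_space_basepoint : K_space := constant_loop R K_basepoint.

Definition K_group (n : nat) := homotopy_group R K_space_basepoint n.

Definition K_zero (n : nat) :=
  homotopy_class (constant_spheroid R K_space_basepoint n).

End KTheory.

Arguments K_group R W n : clear implicits.
Arguments K_zero R W n : clear implicits.

(* Main.v *)
(** In either case every map between cofibrant objects is a cofibration.  For a
    localization all maps are cofibrations.  For a colocalization all maps are
    fibrations, so acyclic cofibrations are isomorphisms; then the fold map of a
    cofibrant object is a cofibration, and lifts from cofibrant objects against
    weak equivalences exist uniquely, which makes every map between cofibrant
    objects a cofibration (and every weak equivalence between them invertible).

    In particular [a -> 0] is always a cofibration, with cofiber [0], so
    [(A_1 -> ... -> A_q) |-> (A_1 -> ... -> A_q -> 0)] is an extra degeneracy of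
    [wS].  Geometrically, every simplex [s x t] is coned off, in the second
    direction, to the vertex of a degenerate simplex of the base point; this is
    a contraction of the realization that fixes the base point, and it acts on
    loops.  The homotopy descends to the quotient because the unit interval is
    locally compact: it is a map into a space of paths. *)

From mathcomp Require Import all_boot all_order all_algebra.
From mathcomp Require Import all_classical all_reals topology normedtype homotopy.
From Stdlib Require Import Relations.
Require Import Defs.

Set Implicit Arguments.
Unset Strict Implicit.
Unset Printing Implicit Defensive.
Import Order.TTheory GRing.Theory Num.Theory.
Import numFieldTopology.Exports numFieldNormedType.Exports.
Local Open Scope classical_set_scope.
Local Open Scope ring_scope.
Local Open Scope quotient_scope.

(** * Terminal objects and pushouts from finite limits and colimits *)

Section FiniteColimits.
Variable C : category.

Lemma finite_preorder_category (T : finType) (le : T -> T -> Prop) le_refl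
    le_trans :
  finite_category (@preorder_category T le le_refl le_trans).
Proof.
split=> [|i j]; first exact: finite_finset.
have [ij|nij] := pselect (le i j).
  apply: (@sub_finite_set _ _ [set ij]); last exact: finite_set1.
  by move=> f _; exact: preorder_hom_eq.
apply: (@sub_finite_set _ _ set0); last exact: finite_set0.
by move=> f; case: nij.
Qed.

(** A limit of the empty diagram is terminal, because a cone over it is nothing but its apex. *)
Lemma terminal_exists : finitely_complete C -> exists t : C, is_terminal t.
Proof.
move=> cC.
pose J := @preorder_category void (fun _ _ => True) (fun _ => I) (fun _ _ _ _ _ => I).
have e (a : J) : False by case: a.
pose F (b : C) : functor J C :=
  @Functor J C (fun _ => b) (fun _ _ _ => idm b) (fun _ => erefl)
    (fun _ _ _ _ _ => esym (comp1m _)).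
(* The empty diagram is written as constant at an object [b]; if [C] had no object, the apex of a
   limit would still be one. *)
have [i0|ni] := pselect (exists b : C, True); last first.
  have [|c _] := cC J _ (@Functor J C (fun a => False_rect _ (e a))
     (fun a _ _ => False_rect _ (e a)) (fun a => False_ind _ (e a))
     (fun a _ _ _ _ => False_ind _ (e a))).
    exact: finite_preorder_category.
  by case: ni; exists (apex c).
case: i0 => b _.
have [|c cl] := cC J _ (F b); first exact: finite_preorder_category.
exists (apex c) => a.
have [h [_ hu]] := cl (@Cone C J (F b) a (fun j => False_rect _ (e j))
   (fun j _ _ => False_ind _ (e j))).
by exists h; split=> // k _; apply: hu => j; case: (e j).
Qed.

(** [pointed_category] gives an isomorphism only once some terminal object is at hand, hence
    [terminal_exists]; terminality then passes along the isomorphism. *)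
Lemma pointed_initial_terminal (z : C) :
  finitely_complete C -> pointed_category C -> is_initial z -> is_terminal z.
Proof.
move=> cC pC z0; have [t t1] := terminal_exists cC.
have [f [g [gf _]]] := pC _ _ z0 t1; move=> b.
have [h [_ hu]] := t1 b; exists (g \oc h); split=> // k _.
by rewrite (hu (f \oc k)) // compmA gf comp1m.
Qed.

(** [None] is the greatest element: diagrams are taken in [opposite C], where an arrow from [Some _]
    to [None] is a map of [C] out of the corner [a]. *)
Definition span_le (x y : option bool) : Prop := (x == y) || (y == None).

Lemma span_le_refl x : span_le x x.
Proof. by rewrite /span_le eqxx. Qed.

Lemma span_le_trans x y z : span_le x y -> span_le y z -> span_le x z.
Proof. by case: x y z => [[]|] [[]|] [[]|]. Qed.

Definition span_shape := preorder_category span_le_refl span_le_trans.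

Section Span.
Variables (a b c : C) (f : hom a b) (g : hom a c).

Definition span_obj (x : span_shape) : opposite C :=
  match x with None => a | Some true => b | Some false => c end.

Definition span_map (x y : span_shape) :
    hom x y -> hom (span_obj x) (span_obj y) :=
  match x, y return span_le x y -> hom (span_obj x) (span_obj y) with
  | None, None => fun _ => idm a
  | Some true, None => fun _ => f
  | Some false, None => fun _ => g
  | Some true, Some true => fun _ => idm b
  | Some false, Some false => fun _ => idm c
  | None, Some _ => fun e => False_rect _ (notF e)
  | Some true, Some false => fun e => False_rect _ (notF e)
  | Some false, Some true => fun e => False_rect _ (notF e)
  end.

Definition span_functor : functor span_shape (opposite C).
Proof.
refine (@Functor span_shape (opposite C) span_obj span_map _ _).
- by case=> [[]|].
- by case=> [[]|] [[]|] [[]|] //= ? ?; rewrite ?compm1 ?comp1m.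
Defined.

Definition span_cone (e : C) (u : hom b e) (v : hom c e)
  (uv : u \oc f = v \oc g) : cone span_functor.
Proof.
refine (@Cone (opposite C) span_shape span_functor e
  (fun j => match j return @hom (opposite C) e (span_obj j) with
     None => u \oc f | Some true => u | Some false => v end) _).
by case=> [[]|] [[]|] //= ?; rewrite ?compm1.
Defined.

Lemma pushout_exists : finitely_cocomplete C ->
  exists (d : C) (f' : hom c d) (g' : hom b d), is_pushout f g f' g'.
Proof.
move=> cC; have [|k kl] := cC span_shape _ span_functor.
  exact: finite_preorder_category.
exists (apex k), (leg k (Some false)), (leg k (Some true)).
pose tb : @hom span_shape (Some true) None := erefl.
pose tc : @hom span_shape (Some false) None := erefl.
split=> [|e u v uv].
  by have := leg_natural k tb; have /= <- := leg_natural k tc.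
have [h [hl hu]] := kl (span_cone uv); exists h; split.
  by have /= := hl (Some true); have /= := hl (Some false).
move=> h' [hb hc]; apply: hu => -[[]|] //=.
by have /= <- := leg_natural k tb; rewrite -hb compmA.
Qed.

End Span.

Lemma pushout_hom_eq (a b c d e : C) (f : hom a b) (g : hom a c)
    (f' : hom c d) (g' : hom b d) (h h' : hom d e) :
  is_pushout f g f' g' -> h \oc g' = h' \oc g' -> h \oc f' = h' \oc f' -> h = h'.
Proof.
move=> [sq po] hb hc.
have [|k [_ ku]] := po e (h \oc g') (h \oc f'); first by rewrite -!compmA sq.
by rewrite -(ku h) // -(ku h').
Qed.

Lemma pushout_lifts (a b c d x y : C) (f : hom a b) (g : hom a c)
    (f' : hom c d) (g' : hom b d) (p : hom x y) :
  is_pushout f g f' g' -> lifts f p -> lifts f' p.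
Proof.
move=> po fp u v pu; have [sq ex] := po.
have [|h [hf ph]] := fp (u \oc g) (v \oc g').
  by rewrite compmA pu -!compmA sq.
have [k [[kg kf] _]] := ex x h u hf.
exists k; split=> //; apply: (pushout_hom_eq po).
- by rewrite -compmA kg.
- by rewrite -compmA kf.
Qed.

End FiniteColimits.

Lemma initial_hom_eq (C : category) (z a : C) (f g : hom z a) :
  is_initial z -> f = g.
Proof. by move=> /(_ a)[h [_ hu]]; rewrite -(hu f) // -(hu g). Qed.

Lemma terminal_hom_eq (C : category) (z a : C) (f g : hom a z) :
  is_terminal z -> f = g.
Proof. by move=> /(_ a)[h [_ hu]]; rewrite -(hu f) // -(hu g). Qed.

Lemma initial_hom (C : category) (z a : C) : is_initial z ->
  exists f : hom z a, True.
Proof. by move=> /(_ a)[f _]; exists f. Qed.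

(** * Cofibrations, weak equivalences and uniqueness of lifts *)

Section ModelCategory.
Variables (C : category) (M : model_structure C).

(** Uniqueness only: together with [lifts] it says that [f] and [p] are orthogonal. *)
Definition unique_lifts (a b x y : C) (f : hom a b) (p : hom x y) :=
  forall h h' : hom b x, h \oc f = h' \oc f -> p \oc h = p \oc h' -> h = h'.

(** The axioms do not list identities among the weak equivalences; factoring one as [p \oc i] makes
    it a retract of the weak equivalence [i]. *)
Lemma weq_id (a : C) : weq M (idm a).
Proof.
have [c [i [p [e _ wi _]]]] := factor_acof_fib M (idm a).
apply: (weq_retract (m := M) (g := i)) => //.
by exists (idm a), (idm a), i, p; split; rewrite ?comp1m ?compm1.
Qed.

Lemma cof_comp (a b c : C) (g : hom b c) (f : hom a b) :
  cof M g -> cof M f -> cof M (g \oc f).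
Proof.
move=> /cofP cg /cofP cf; apply/cofP => x y p fp wp u v e.
have [|h [hf ph]] := cf _ _ p fp wp u (v \oc g); first by rewrite e compmA.
have [k [kg pk]] := cg _ _ p fp wp h v ph.
by exists k; split=> //; rewrite compmA kg.
Qed.

Lemma cof_iso (a b : C) (f : hom a b) : is_iso f -> cof M f.
Proof. by move=> /iso_liftsP fi; apply/cofP => x y p _ _; exact: fi. Qed.

Lemma weq_iso (a b : C) (f : hom a b) : is_iso f -> weq M f.
Proof.
move=> fi; apply: proj2; apply/(acofP M) => x y p _.
by move/iso_liftsP: fi; apply.
Qed.

Lemma cof_pushout (a b c d : C) (f : hom a b) (g : hom a c)
    (f' : hom c d) (g' : hom b d) :
  is_pushout f g f' g' -> cof M f -> cof M f'.
Proof.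
move=> po /cofP cf; apply/cofP => x y p fp wp.
by apply: pushout_lifts po _; exact: cf.
Qed.

(* An acyclic cofibration is orthogonal to fibrations as soon as the fold map
   of its cokernel pair is a cofibration. *)
Lemma acof_unique_lifts (a b x y : C) (f : hom a b) (p : hom x y) :
  finitely_cocomplete C -> (forall (c d : C) (g : hom c d), cof M g) ->
  weq M f -> fib M p -> unique_lifts f p.
Proof.
move=> cC call wf fp h h' hf ph.
have [d [i [j po]]] := pushout_exists f f cC.
have [k [[kj ki] _]] := po.2 _ (idm b) (idm b) erefl.
have wi : weq M i.
  suff: cof M i /\ weq M i by case.
  apply/(acofP M) => x' y' p' fp'; apply: (pushout_lifts po).
  by apply/(acofP M) : x' y' p' fp'.
have wk : weq M k.
  have [_ + _] := weq_two_of_three M i k; apply=> //.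
  by rewrite ki; exact: weq_id.
have [l [[lj li] _]] := po.2 _ h h' hf.
(* The lift satisfies [m \oc k = l]; restricting along [j] and [i], both sections of [k], gives
   [h = m] and [h' = m]. *)
have [|m [mk _]] := proj1 (acofP M k) (conj (call _ _ _) wk) _ _ p fp l (p \oc h).
  apply: (pushout_hom_eq po); first by rewrite -!compmA lj kj compm1.
  by rewrite -!compmA li ki compm1.
by rewrite -lj -li -mk -!compmA kj ki.
Qed.

Section AllFibrations.
Hypothesis fib_all : forall (a b : C) (f : hom a b), fib M f.

(** An acyclic cofibration lifts against every fibration, here against every map, and lifting
    against itself yields an inverse. *)
Lemma acof_is_iso (a b : C) (f : hom a b) : cof M f -> weq M f -> is_iso f.
Proof.
move=> cf wf; apply/iso_liftsP => x y p.
by apply: (proj1 (acofP M f)); [split|exact: fib_all].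
Qed.

(** With all maps fibrations, the weak equivalence [p] is an acyclic fibration, against which the
    cofibration [z -> x] lifts. *)
Lemma cofibrant_lift (z : C) (x e b : C) (p : hom e b) (v : hom x b) :
  is_initial z -> cofibrant M x -> weq M p -> exists h, p \oc h = v.
Proof.
move=> z0 cx wp; have [f _] := initial_hom x z0.
have [g _] := initial_hom e z0.
have /cofP cf := cx z f z0.
have [|h [_ ph]] := cf _ _ p (fib_all p) wp g v; first exact: initial_hom_eq.
by exists h.
Qed.

(* [x + x -> cylinder] composed with the (invertible) projection to [x] is the
   fold map, so the fold map of a cofibrant object is a cofibration. *)
Lemma cofibrant_lift_unique (z : C) (x e b : C) (p : hom e b) (h h' : hom x e) :
  finitely_cocomplete C -> is_initial z -> cofibrant M x -> weq M p ->
  p \oc h = p \oc h' -> h = h'.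
Proof.
move=> cC z0 cx wp ph.
have [f _] := initial_hom x z0.
have [s [i [j po]]] := pushout_exists f f cC.
have ci : cof M i by apply: cof_pushout po _; exact: cx.
have [k [[kj ki] _]] := po.2 _ (idm x) (idm x) erefl.
have [c [l [q [ql cl _ wq]]]] := factor_cof_afib M k.
have wli : weq M (l \oc i).
  have [_ _] := weq_two_of_three M (l \oc i) q; apply=> //.
  by rewrite compmA ql ki; exact: weq_id.
have [m [ml lm]] := acof_is_iso (cof_comp cl ci) wli.
(* [q] is a left inverse of the invertible map [l \oc i], so it is its inverse and in particular a
   cofibration. *)
have qE : q = m by rewrite -[q]compm1 -lm 2!compmA ql ki comp1m.
have ck : cof M k.
  by rewrite -ql; apply: cof_comp cl; apply: cof_iso; exists (l \oc i); rewrite qE.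
move/cofP: ck => ck.
have [t [[tj ti] _]] := po.2 _ h h' (initial_hom_eq _ _ z0).
have [|n [nk _]] := ck _ _ p (fib_all p) wp t (p \oc h).
  apply: (pushout_hom_eq po); first by rewrite -!compmA tj kj compm1.
  by rewrite -!compmA ti ki compm1.
by rewrite -tj -ti -nk -!compmA kj ki.
Qed.

(** Cofibrancy of [y] gives some [h] over [v]; that [h] extends [u] follows because maps out of the
    cofibrant [x] are determined by their composite with [p]. *)
Lemma cofibrant_cof (z : C) (x y : C) (f : hom x y) :
  finitely_cocomplete C -> is_initial z -> cofibrant M x -> cofibrant M y ->
  cof M f.
Proof.
move=> cC z0 cx cy; apply/cofP => e b p _ wp u v pu.
have [h ph] := cofibrant_lift v z0 cy wp.
exists h; split=> //; apply: (cofibrant_lift_unique cC z0 cx wp).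
by rewrite compmA ph pu.
Qed.

Lemma cofibrant_weq_iso (z : C) (x y : C) (f : hom x y) :
  finitely_cocomplete C -> is_initial z -> cofibrant M x -> cofibrant M y ->
  weq M f -> is_iso f.
Proof.
by move=> cC z0 cx cy wf; apply: acof_is_iso => //; exact: (cofibrant_cof _ cC z0).
Qed.

End AllFibrations.
End ModelCategory.

(** The pushout [d] is tested only on objects satisfying [P], but the ambient pushout [e] is one of
    them. Comparing the two makes [d] a retract of [e], compatibly with the cocones, and
    factorizations carry over. *)
Lemma full_pushout (C : category) (P : C -> Prop)
    (a b c d : full_subcategory P) (f : hom a b) (g : hom a c)
    (f' : hom c d) (g' : hom b d) :
  (exists (e : full_subcategory P) (f0 : hom c e) (g0 : hom b e),
    is_pushout (C := C) f g f0 g0) ->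
  is_pushout f g f' g' -> is_pushout (C := C) f g f' g'.
Proof.
move=> [e [f0 [g0 po]]] [sq ex]; split=> // x u v uv.
have [h0 [[h0g h0f] _]] := po.2 x u v uv.
have [k [[/= kg kf] _]] := ex e g0 f0 po.1.
have [l [[lg lf] _]] := po.2 _ g' f' sq.
have [i [_ iu]] := ex d g' f' sq.
have lk : l \oc k = idm (sval d).
  rewrite -(iu (l \oc k)) /=; last by rewrite -!compmA kg kf.
  by apply: (iu (idm d)); rewrite /= !comp1m.
exists (h0 \oc k); split; first by rewrite -!compmA kg kf.
move=> h [hg hf]; rewrite -[h]compm1 -lk compmA; congr (_ \oc _).
by apply: (pushout_hom_eq po); rewrite -compmA ?lg ?lf ?hg ?hf.
Qed.

(** * The Waldhausen structure on cofibrant objects *)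

Section CofibrantObjects.
Variables (C : category) (M : model_structure C) (z : C).
Hypotheses (cC : finitely_complete C) (ccC : finitely_cocomplete C)
  (pC : pointed_category C) (z0 : is_initial z).

Hypothesis cofibrant_cof : forall (x y : C) (f : hom x y),
  cofibrant M x -> cofibrant M y -> cof M f.

Hypothesis cofibrant_weq_unique_lifts : forall (x y e b : C) (f : hom x y)
  (p : hom e b), cofibrant M x -> cofibrant M y -> weq M f -> fib M p ->
  unique_lifts f p.

Let W := full_subcategory (cofibrant M).

(** The ambient pushout is cofibrant: the map to it from an initial object passes through [c], and
    the cobase change [f'] is a cofibration. *)
Lemma cofibrant_pushout_ex (a b c : W) (f : hom a b) (g : hom a c) :
  exists (e : W) (f0 : hom c e) (g0 : hom b e), is_pushout (C := C) f g f0 g0.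
Proof.
have [d [f' [g' po]]] := pushout_exists (C := C) f g ccC.
have cd : cofibrant M d.
  move=> i h i0; have [u _] := initial_hom (sval c) i0.
  rewrite -(initial_hom_eq (f' \oc u) h i0); apply: cof_comp.
    by apply: cof_pushout po _; exact: cofibrant_cof (svalP a) (svalP b).
  exact: (svalP c).
by exists (exist _ d cd), f', g'.
Qed.

Lemma cofibrant_pushout (a b c d : W) (f : hom a b) (g : hom a c)
    (f' : hom c d) (g' : hom b d) :
  is_pushout f g f' g' -> is_pushout (C := C) f g f' g'.
Proof. by apply: full_pushout; exact: cofibrant_pushout_ex. Qed.

Lemma cofibrant_objects_waldhausen : is_waldhausen (cofibrant_objects M z0).
Proof.
split.
- move=> b; have [h [_ hu]] := z0 (sval b).
  by exists h; split=> // k _; exact: hu.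
- move=> b; have [h [_ hu]] := pointed_initial_terminal cC pC z0 (sval b).
  by exists h; split=> // k _; exact: hu.
- by move=> a b f _; exact: cofibrant_cof (svalP a) (svalP b).
- by move=> a b c g f; exact: cof_comp.
- by move=> a f; exact: cofibrant_cof (initial_cofibrant M z0) (svalP a).
- move=> a b c f g _; have [d [f' [g' [sq po]]]] := cofibrant_pushout_ex f g.
  by exists d, f', g'; split=> // e; exact: po.
- by move=> a b c d f g f' g' _ _; exact: cofibrant_cof (svalP c) (svalP d).
- move=> a b f [g [gf fg]]; apply: (@weq_iso C M); by exists g.
- by move=> a b c g f wg wf; have [+ _ _] := weq_two_of_three M f g; exact.
- move=> a b c d a' b' c' d' f g h k f' g' h' k' u v w t.
  move=> _ /cofibrant_pushout po _ /cofibrant_pushout po' wu wv ww vf wg th tk.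
  (* Gluing axiom: [t] is shown to lift against every fibration, which makes it an acyclic
     cofibration. *)
  apply: proj2; apply/(acofP M) => x y p fp r s pr.
  have lift (m n : W) (j : hom m n) : weq M j -> lifts (C := C) j p.
    move=> wj; apply: (proj1 (acofP M j)) => //; split=> //.
    exact: cofibrant_cof (svalP m) (svalP n).
  have [|lb [lbv plb]] := lift _ _ v wv (r \oc k) (s \oc k').
    by rewrite compmA pr -!compmA; congr (_ \oc _).
  have [|lc [lcw plc]] := lift _ _ w ww (r \oc h) (s \oc h').
    by rewrite compmA pr -!compmA; congr (_ \oc _).
  (* The lifts on [b'] and [c'] are chosen independently; on [a'] they agree, as both solve the same
     lifting problem along [u], whose solution is unique. *)
  have lbc : lb \oc f' = lc \oc g'.
    apply: (cofibrant_weq_unique_lifts (svalP a) (svalP a') wu fp).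
      have e1 : lb \oc f' \oc u = r \oc k \oc f.
        by rewrite -lbv -!compmA; congr (_ \oc _); exact: esym.
      have e2 : lc \oc g' \oc u = r \oc h \oc g.
        by rewrite -lcw -!compmA; congr (_ \oc _); exact: esym.
      by rewrite e1 e2 -!compmA; congr (_ \oc _); exact: po.1.
    by rewrite !compmA plb plc -!compmA; congr (_ \oc _); exact: po'.1.
  have [l [[lk lh] _]] := po'.2 _ lb lc lbc.
  exists l; split.
    apply: (pushout_hom_eq po).
      by rewrite -lbv -lk -!compmA; congr (_ \oc _).
    by rewrite -lcw -lh -!compmA; congr (_ \oc _).
  by apply: (pushout_hom_eq po'); rewrite -compmA ?lk ?lh.
Qed.

End CofibrantObjects.

(** * Localizations and colocalizations of the discrete model structure *)

Section BousfieldDiscrete.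
Variables (C : category) (M : model_structure C).
Hypotheses (ccC : finitely_cocomplete C)
  (M_local : bousfield_localization (discrete_model C) M \/
             bousfield_colocalization (discrete_model C) M).

Lemma discrete_local_cofibrant_cof (z : C) (x y : C) (f : hom x y) :
  is_initial z -> cofibrant M x -> cofibrant M y -> cof M f.
Proof.
case: M_local => -[all _] z0 cx cy; first exact/all.
by apply: (cofibrant_cof _ _ ccC z0) => // a b g; exact/all.
Qed.

(** For a localization this is the cokernel pair argument; for a colocalization [f] is invertible,
    hence an epimorphism. *)
Lemma discrete_local_unique_lifts (z : C) (x y e b : C) (f : hom x y)
    (p : hom e b) :
  is_initial z -> cofibrant M x -> cofibrant M y -> weq M f -> fib M p ->
  unique_lifts f p.
Proof.
case: M_local => -[all _] z0 cx cy wf fp.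
  by apply: (@acof_unique_lifts C M) => // c d g; exact/all.
have fib_all (a c : C) (g : hom a c) : fib M g by exact/all.
have [g [gf fg]] := cofibrant_weq_iso fib_all ccC z0 cx cy wf.
by move=> h h' hf _; rewrite -[h]compm1 -fg compmA hf -compmA fg compm1.
Qed.

End BousfieldDiscrete.

(** * Comparison of maps with equal endpoints, and maps of the simplex category *)

Definition total_hom (C : category) (a b : C) (f : hom a b) :
    {ab : C * C & hom ab.1 ab.2} :=
  existT (fun ab : C * C => hom ab.1 ab.2) (a, b) f.

(** Bundling a map with its endpoints allows comparisons when these are equal but not convertible.
    On parallel maps nothing is lost, by irrelevance of equality proofs. *)
Lemma total_hom_inj (C : category) (a b : C) : injective (@total_hom C a b).
Proof.
by move=> f g e; have := projT2_eq e; rewrite (Prop_irrelevance (projT1_eq e) erefl).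
Qed.

Lemma ar_eq q (x y : ar q) : src x = src y -> tgt x = tgt y -> x = y.
Proof.
case: x y => [s t st] [s' t' st'] /= es et; subst.
by congr Ar; exact: bool_irrelevance.
Qed.

Lemma last_degeneracy_le q (i j : 'I_q.+2) : (i <= j)%N ->
  ((inord (minn i q) : 'I_q.+1) <= (inord (minn j q) : 'I_q.+1))%N.
Proof.
move=> ij; rewrite !inordK ?ltnS ?geq_minr //.
by rewrite leq_min geq_minr (leq_trans (geq_minl _ _) ij).
Qed.

Definition last_degeneracy q : simplex_map q.+1 q :=
  SimplexMap (@last_degeneracy_le q).

Definition last_face q : simplex_map q q.+1 :=
  @SimplexMap q q.+1 (widen_ord (leqnSn q.+1)) (fun i j ij => ij).

Definition last_vertex q : simplex_map 0 q :=
  @SimplexMap 0 q (fun=> ord_max) (fun _ _ _ => leqnn _).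

Definition to_point q : simplex_map q 0 :=
  @SimplexMap q 0 (fun=> ord0) (fun _ _ _ => leqnn _).

(** The join of [ph] with the identity of a point: the added last vertex goes to the added last
    vertex, and the others follow [ph]. *)
Definition cone_map p q (ph : simplex_map p q) : simplex_map p.+1 q.+1.
Proof.
refine (@SimplexMap p.+1 q.+1 (fun i => if (p < i)%N then ord_max
  else last_face q (ph (last_degeneracy p i))) _) => i j ij.
have [pj|jp] := ltnP p j; first exact: leq_ord.
rewrite ltnNge (leq_trans ij jp).
exact: (smap_le ph (smap_le (last_degeneracy p) ij)).
Defined.

Lemma last_degeneracyE q (i : 'I_q.+2) :
  (i <= q)%N -> last_degeneracy q i = i :> nat.
Proof. by move=> iq; rewrite /= inordK ?ltnS ?geq_minr //; exact/minn_idPl. Qed.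

Lemma last_degeneracy_face q (i : 'I_q.+1) :
  last_degeneracy q (last_face q i) = i.
Proof. by apply: ord_inj; rewrite last_degeneracyE //; exact: (leq_ord i). Qed.

Lemma cone_map_last p q (ph : simplex_map p q) (i : 'I_p.+2) :
  (q < cone_map ph i)%N = (p < i)%N.
Proof.
rewrite /=; have [//|ip] := ltnP p i; first by rewrite ltnSn.
by apply/negbTE; rewrite -leqNgt; exact: (leq_ord (ph _)).
Qed.

Lemma last_degeneracy_cone_map p q (ph : simplex_map p q) (i : 'I_p.+2) :
  (i <= p)%N ->
  last_degeneracy q (cone_map ph i) = ph (last_degeneracy p i).
Proof.
move=> ip.
suff -> : cone_map ph i = last_face q (ph (last_degeneracy p i)).
  exact: last_degeneracy_face.
by rewrite /cone_map /= ltnNge ip.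
Qed.

(** * The extra degeneracy of the S-construction *)

Section ExtraDegeneracy.
Variable W : waldhausen_category.
Hypothesis wcof_all : forall (a b : W) (f : hom a b), wcof W f.

Definition zero_object (a : W) := is_initial a /\ is_terminal a.

Lemma wzero_zero : zero_object (wzero W).
Proof. by split; [exact: wzero_initial (wP W)|exact: wzero_terminal (wP W)]. Qed.

Definition from_zero (a : W) : hom (wzero W) a :=
  sval (cid (wzero_initial (wP W) a)).

Definition to_zero (a : W) : hom a (wzero W) :=
  sval (cid (wzero_terminal (wP W) a)).

Definition kill_obj (b : bool) (x : W) : W := if b then wzero W else x.

Definition kill_map (b c : bool) (x y : W) (f : hom x y) :
    hom (kill_obj b x) (kill_obj c y) :=
  match b, c return hom (kill_obj b x) (kill_obj c y) with
  | false, false => f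
  | b, true => to_zero (kill_obj b x)
  | true, false => from_zero y
  end.

Lemma kill_map_id b x : kill_map b b (idm x) = idm (kill_obj b x).
Proof. by case: b => //=; apply: terminal_hom_eq; exact: wzero_zero.2. Qed.

(** The implications exclude composites that pass through zero between two surviving objects, where
    the original map would be lost. *)
Lemma kill_map_comp b c d (x y z : W) (g : hom y z) (f : hom x y) :
  (b ==> c) -> (c ==> d) ->
  kill_map c d g \oc kill_map b c f = kill_map b d (g \oc f).
Proof.
case: d => [_ _|]; first by apply: terminal_hom_eq; exact: wzero_zero.2.
by case: c => //; case: b.
Qed.

Lemma kill_map_weq b (x y : W) (f : hom x y) :
  wweq W f -> wweq W (kill_map b b f).
Proof.
case: b => //= _; rewrite (_ : to_zero _ = idm _).
  by apply: (wweq_iso (wP W)); exact: iso_id.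
by apply: terminal_hom_eq; exact: wzero_zero.2.
Qed.

Lemma total_kill_map b c (x y x' y' : W) (f : hom x y) (f' : hom x' y') :
  (b = false -> x = x') -> (c = false -> y = y') ->
  (b = false -> c = false -> total_hom f = total_hom f') ->
  total_hom (kill_map b c f) = total_hom (kill_map b c f').
Proof.
case: b c => [] [] //= ex ey ef.
- by rewrite ey.
- by rewrite ex.
- exact: ef.
Qed.

Lemma zero_pushout (a b c d : W) (f : hom a b) (g : hom a c) (f' : hom c d)
    (g' : hom b d) :
  zero_object b -> zero_object c -> zero_object d -> is_pushout f g f' g'.
Proof.
move=> [b0 _] [c0 _] [d0 d1]; split; first exact: terminal_hom_eq.
move=> e u v _; have [h _] := initial_hom e d0; exists h.
by split=> [|k _]; [split|]; exact: initial_hom_eq.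
Qed.

(** The entry at [(i, j)] is the quotient of the [j]-th object of the chain by the [i]-th; for the
    appended zero object, [j = q.+1], this quotient is zero. *)
Definition killed q (x : ar q.+1) : bool := (q < tgt x)%N.

Lemma killed_le q (x y : ar_category q.+1) : hom x y -> killed x ==> killed y.
Proof. by move=> [_ xy]; apply/implyP => qx; exact: leq_trans qx xy. Qed.

(* The raw form of (A_1 -> ... -> A_q) |-> (A_1 -> ... -> A_q -> 0). *)
Definition raw_extend p q (r : raw_cell W p q) : raw_cell W p q.+1 :=
  let s := ar_map (last_degeneracy q) in
  @RawCell W p q.+1 (fun a x => kill_obj (killed x) (raw_obj r a (s x)))
    (fun a x y f => kill_map (killed x) (killed y) (raw_map r a (fmap s f)))
    (fun a b h x => kill_map (killed x) (killed x) (raw_weq r h (s x))).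

Lemma raw_extend_cell p q (r : raw_cell W p q) :
  is_cell r -> is_cell (raw_extend r).
Proof.
move=> ok; split=> /=.
- move=> a x; rewrite -kill_map_id -(rc_id ok).
  exact: (congr1 (fun h => kill_map _ _ (raw_map r a h)) (preorder_hom_eq _ _)).
- move=> a x y z g f; rewrite kill_map_comp ?killed_le //.
  rewrite -(rc_comp ok).
  exact: (congr1 (fun h => kill_map _ _ (raw_map r a h)) (preorder_hom_eq _ _)).
- by move=> a i ii; rewrite (rc_diag ok); rewrite /kill_obj; case: ifP.
(* Here the maps into the appended zero object have to be cofibrations. *)
- by move=> *; exact: wcof_all.
- move=> a i j k ij ik jj jk f g f' g'; rewrite /killed /=.
  (* If [k] is the added index, all corners of the square except the first are zero objects: the
     cofiber of a map to zero is zero. *)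
  case: (boolP (q < k)%N) => [qk|].
    apply: zero_pushout; [exact: wzero_zero| |exact: wzero_zero].
    rewrite (_ : kill_obj _ _ = wzero W); first exact: wzero_zero.
    by rewrite (rc_diag ok) /kill_obj; case: ifP.
  rewrite -leqNgt => kq; rewrite [(q < j)%N]ltnNge (leq_trans jk kq) /=.
  exact: (rc_quot ok).
- move=> a b h x y f; rewrite !kill_map_comp ?killed_le ?implybb //.
  by rewrite (rc_natural ok).
- by move=> a b h x; apply: kill_map_weq; exact: (rc_weq ok).
- by move=> a x; rewrite (rc_weq_id ok) kill_map_id.
- by move=> a b c k h x; rewrite (rc_weq_comp ok) kill_map_comp ?implybb.
Qed.

Definition extend p q (x : wS W p q) : wS W p q.+1 :=
  cook (raw_extend_cell (raw_is_cell x)).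

Lemma raw_cell_eq p q (r r' : raw_cell W p q) :
  (forall a x, raw_obj r a x = raw_obj r' a x) ->
  (forall a x y (f : hom x y),
    total_hom (raw_map r a f) = total_hom (raw_map r' a f)) ->
  (forall a b (h : hom a b) x,
    total_hom (raw_weq r h x) = total_hom (raw_weq r' h x)) -> r = r'.
Proof.
case: r r' => [o m w] [o' m' w'] /= eo em ew.
have eoo : o = o'.
  by apply/functional_extensionality_dep => a; apply/functional_extensionality_dep.
subst o'; congr RawCell.
  by do 4 apply: functional_extensionality_dep => ?; apply: total_hom_inj.
by do 4 apply: functional_extensionality_dep => ?; apply: total_hom_inj.
Qed.

Lemma total_raw_map p q (r : raw_cell W p q) a (x y x' y' : ar_category q)
    (f : hom x y) (f' : hom x' y') : x = x' -> y = y' ->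
  total_hom (raw_map r a f) = total_hom (raw_map r a f').
Proof.
by move=> ex ey; subst; rewrite (preorder_hom_eq f f').
Qed.

Lemma raw_cell_zero p q (r r' : raw_cell W p q) :
  (forall a x, raw_obj r a x = wzero W) ->
  (forall a x, raw_obj r' a x = wzero W) -> r = r'.
Proof.
have key (a b a' b' : W) (f : hom a b) (f' : hom a' b') :
    a = wzero W -> b = wzero W -> a' = wzero W -> b' = wzero W ->
    total_hom f = total_hom f'.
  move=> ? ? ? ?; subst; congr total_hom.
  by apply: terminal_hom_eq; exact: wzero_zero.2.
by move=> z z'; apply: raw_cell_eq => *; rewrite ?z ?z' //; exact: key.
Qed.

(** [cone_map ph] respects the added vertex, so the same entries are killed on both sides; on the
    surviving ones the last degeneracies commute with [ph]. *)
Lemma extend_face p p' q q' (th : simplex_map p' p) (ph : simplex_map q' q)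
    (x : wS W p q) :
  extend (face th ph x) = face th (cone_map ph) (extend x).
Proof.
apply: raw_inj.
have kE (y : ar q'.+1) : killed (ar_map (cone_map ph) y) = killed y.
  exact: cone_map_last.
have sE (y : ar q'.+1) : killed y = false ->
    ar_map ph (ar_map (last_degeneracy q') y) =
    ar_map (last_degeneracy q) (ar_map (cone_map ph) y).
  move/negbT; rewrite /killed -leqNgt => yq.
  apply: ar_eq; apply/esym/last_degeneracy_cone_map => //.
  exact: leq_trans (src_le_tgt y) yq.
apply: raw_cell_eq => /=.
- move=> a y; rewrite kE /kill_obj; case: ifP => // ky.
  exact: (congr1 (x (th a)) (sE _ ky)).
- move=> a y1 y2 f; rewrite !kE; apply: total_kill_map => [k1|k2|k1 k2].
  + exact: (congr1 (x (th a)) (sE _ k1)).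
  + exact: (congr1 (x (th a)) (sE _ k2)).
  + by apply: (total_raw_map (raw x)); exact: sE.
- move=> a b h y; rewrite kE; apply: total_kill_map => [k|k|k _].
  + exact: (congr1 (x (th a)) (sE _ k)).
  + exact: (congr1 (x (th b)) (sE _ k)).
  + exact: (congr1 (fun y => total_hom (raw_weq (raw x) (smap_le th h) y)) (sE _ k)).
Qed.

Lemma face_extend_last p q (x : wS W p q) :
  face (simplex_id p) (last_face q) (extend x) = x.
Proof.
apply: raw_inj.
have kE (y : ar q) : killed (ar_map (last_face q) y) = false.
  by apply/negbTE; rewrite /killed -leqNgt; exact: (leq_ord (tgt y)).
have sE (y : ar q) : ar_map (last_degeneracy q) (ar_map (last_face q) y) = y.
  by apply: ar_eq; exact: last_degeneracy_face.
apply: raw_cell_eq => /=.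
- by move=> a y; rewrite kE; exact: (congr1 (x a) (sE y)).
- by move=> a y1 y2 f; rewrite !kE; apply: (total_raw_map (raw x)); exact: sE.
- move=> a b h y; rewrite kE.
  exact: (congr1 (fun y => total_hom (raw_weq (raw x) h y)) (sE y)).
Qed.

(** Over the added vertex only zero entries remain, and a cell with all its objects zero is
    determined by that. *)
Lemma face_extend_vertex p q (x : wS W p q) :
  face (simplex_id p) (last_vertex q.+1) (extend x) =
  face (to_point p) (simplex_id 0) (wS_base W).
Proof.
apply: raw_inj; apply: raw_cell_zero => // a y /=.
by rewrite /killed /= ltnSn.
Qed.

Lemma extend_base :
  extend (wS_base W) = face (simplex_id 0) (to_point 1) (wS_base W).
Proof.
apply: raw_inj; apply: raw_cell_zero => // a y /=.
by rewrite /kill_obj; case: ifP.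
Qed.

End ExtraDegeneracy.

(** * Continuity criteria and the topology of the unit interval *)

Lemma continuous_to_set_type (X Y : topologicalType) (A : set Y)
    (f : X -> set_type A) :
  continuous (set_val \o f) -> continuous f.
Proof. exact: continuous_comp_initial. Qed.

Lemma continuous_to_prod (X : topologicalType) (I : Type)
    (T : I -> topologicalType) (f : X -> prod_topology T) :
  (forall i, continuous (fun x => f x i)) -> continuous f.
Proof.
move=> cf x; apply/cvg_sup => i.
exact: (@continuous_comp_initial _ _ _ (fun g : forall i, T i => g i) f (cf i) x).
Qed.

Section UnitInterval.
Variable R : realType.
Local Notation I := (unit_interval R).

Lemma clamp_in (r : R) : Num.min 1 (Num.max 0 r) \in `[0 : R, 1]%classic.
Proof.
by rewrite inE /= in_itv /= ge_min lexx le_min ler01 le_max lexx.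
Qed.

(** A retraction of the line onto the interval: reparametrizations can be written in real
    arithmetic, and compactness is inherited from the segment. *)
Definition clamp (r : R) : I := exist (fun t => t \in `[0, 1]%classic) _ (clamp_in r).

Lemma clampE (r : R) : 0 <= r <= 1 -> sval (clamp r) = r.
Proof. by move=> /andP[r0 r1]; rewrite /= (max_r r0) min_r. Qed.

Lemma clamp0 : clamp 0 = I0 R.
Proof. by apply: val_inj; apply: clampE; rewrite lexx ler01. Qed.

Lemma clamp1 : clamp 1 = I1 R.
Proof. by apply: val_inj; apply: clampE; rewrite lexx ler01. Qed.

Lemma clampK (t : I) : clamp (set_val t) = t.
Proof.
apply: val_inj; apply: clampE.
by have /set_mem := svalP t; rewrite /= in_itv.
Qed.

Lemma clamp_continuous : continuous clamp.
Proof.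
apply: continuous_to_set_type.
apply: (@min_fun_continuous _ R R (cst 1)); first by move=> ?; exact: cst_continuous.
apply: (@max_fun_continuous _ R R (cst 0) id); last by move=> ?; exact: cvg_id.
by move=> ?; exact: cst_continuous.
Qed.

Lemma unit_interval_compact : compact [set: I].
Proof.
rewrite (_ : setT = clamp @` `[0, 1]).
  apply: continuous_compact; last exact: segment_compact.
  exact/continuous_subspaceT/clamp_continuous.
apply/seteqP; split=> // t _; exists (set_val t); last exact: clampK.
by have /set_mem := svalP t.
Qed.

Lemma unit_interval_hausdorff : hausdorff_space I.
Proof.
move=> s t cl; apply: val_inj; apply: (@Rhausdorff R) => A B sA tB.
have sA' : nbhs s (set_val @^-1` A) by exact: (@initial_continuous I R set_val s).
have tB' : nbhs t (set_val @^-1` B) by exact: (@initial_continuous I R set_val t).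
by have [u [Au Bu]] := cl _ _ sA' tB'; exists (set_val u).
Qed.

Lemma unit_interval_locally_compact : locally_compact [set: I].
Proof.
move=> t _; exists setT; first by rewrite withinET; exact: filterT.
by split; [exact: unit_interval_compact|exact: closedT].
Qed.

End UnitInterval.

Lemma continuous_compose (X Y Z : topologicalType) (g : Y -> Z) (f : X -> Y) :
  continuous g -> continuous f -> continuous (fun x => g (f x)).
Proof. by move=> cg cf x; exact: continuous_comp (cf x) (cg _). Qed.

Lemma continuous_pairing (X Y Z : topologicalType) (f : X -> Y) (g : X -> Z) :
  continuous f -> continuous g -> continuous (fun x => (f x, g x)).
Proof. by move=> cf cg x; exact: cvg_pair (cf x) (cg x). Qed.

Lemma fst_continuous (X Y : topologicalType) : continuous (@fst X Y).
Proof. by move=> x; exact: cvg_fst. Qed.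

Lemma snd_continuous (X Y : topologicalType) : continuous (@snd X Y).
Proof. by move=> x; exact: cvg_snd. Qed.

(** * Homotopies of spheroids and trivial homotopy groups *)

Section Spheroids.
Variables (R : realType) (X : topologicalType) (x : X) (n : nat).
Local Notation I := (unit_interval R).

(** Follow the first homotopy at double speed, then the second one backwards; symmetry and
    transitivity are obtained in one concatenation. *)
Lemma spheroid_homotopic_rev_trans (f g h : spheroid R x n) :
  spheroid_homotopic f h -> spheroid_homotopic g h -> spheroid_homotopic f g.
Proof.
move=> [F [cF F0 F1 Fx]] [G [cG G0 G1 Gx]].
pose half := [set z : cube R n * I | set_val z.2 <= 2^-1].
pose half' := [set z : cube R n * I | 2^-1 <= set_val z.2].
pose F' (z : cube R n * I) := F (z.1, clamp (2 * set_val z.2)).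
(* The parameter decreases from 1 at time 1/2 to 0 at time 1, so that [G] runs from [h] back to
   [g]. *)
pose G' (z : cube R n * I) := G (z.1, clamp (2 - 2 * set_val z.2)).
pose H z := if set_val z.2 <= 2^-1 then F' z else G' z.
have cval : continuous (fun z : cube R n * I => set_val z.2).
  apply: continuous_compose (@snd_continuous _ _).
  exact: (@initial_continuous I R set_val).
have c2val : continuous (fun z : cube R n * I => 2 * set_val z.2).
  by move=> z; apply: cvgM; [exact: cvg_cst|exact: cval].
have cF' : continuous F'.
  apply: (continuous_compose cF); apply: continuous_pairing.
    exact: fst_continuous.
  by apply: (continuous_compose (@clamp_continuous R)).
have cG' : continuous G'.
  apply: (continuous_compose cG); apply: continuous_pairing.
    exact: fst_continuous.
  apply: (continuous_compose (@clamp_continuous R)) => z.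
  by apply: cvgB; [exact: cvg_cst|exact: c2val].
exists H; split.
- apply/continuous_subspace_setT; rewrite (_ : setT = half `|` half').
    apply: withinU_continuous.
    + by move/continuous_closedP: cval => /(_ _ (@closed_le R 2^-1)).
    + by move/continuous_closedP: cval => /(_ _ (@closed_ge R 2^-1)).
    + apply: (@subspace_eq_continuous _ _ _ F'); last exact: continuous_subspaceT.
      by move=> z /set_mem zh; rewrite /from_subspace /H ifT.
    + apply: (@subspace_eq_continuous _ _ _ G'); last exact: continuous_subspaceT.
      move=> z /set_mem z2; rewrite /from_subspace /H; case: ifP => // z2'.
      (* The two halves meet only at time 1/2, where both equal [h]. *)
      have e : set_val z.2 = 2^-1 by apply/eqP; rewrite eq_le z2 z2'.
      rewrite /F' /G' e mulfV ?pnatr_eq0 // (_ : 2 - 1 = 1 :> R).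
        by rewrite clamp1 F1 G1.
      by rewrite -[2]/(1 + 1 : R) addrK.
  apply/seteqP; split=> // z _; rewrite /half /half' /=.
  by case: (leP (set_val z.2) 2^-1) => [|/ltW]; [left|right].
- by move=> c; rewrite /H /F' /= invr_ge0 ler0n mulr0 clamp0 F0.
- move=> c; rewrite /H /G' /= leNgt invf_lt1 ?ltr0n // ltr1n /=.
  by rewrite mulr1 subrr clamp0 G0.
- move=> c t cb; rewrite /H /F' /G' /=.
  by case: ifP => _; [exact: Fx|exact: Gx].
Qed.

Lemma homotopy_group_trivial :
  (forall f : spheroid R x n, spheroid_homotopic f (constant_spheroid R x n)) ->
  homotopy_group R x n = [set homotopy_class (constant_spheroid R x n)].
Proof.
move=> null.
(* Any two spheroids are homotopic through the constant one, so every class is the whole set. *)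
have classT (f : spheroid R x n) : homotopy_class f = setT.
  apply/seteqP; split=> // g _; exact: spheroid_homotopic_rev_trans.
apply/seteqP; split=> [_ [f _ <-]|_ ->]; first by rewrite /= !classT.
by exists (constant_spheroid R x n).
Qed.

End Spheroids.

(** * Contractions acting on loop spaces *)

Section LoopSpace.
Variables (R : realType) (X : topologicalType) (x : X).
Local Notation I := (unit_interval R).

Lemma loop_fun_continuous :
  continuous (fun p : loop_space R x => (p : I -> X) : {compact-open, I -> X}).
Proof. exact: initial_continuous. Qed.

Lemma continuous_to_loop_space (T : topologicalType) (f : T -> loop_space R x) :
  continuous (fun z => (f z : I -> X) : {compact-open, I -> X}) -> continuous f.
Proof. exact: continuous_comp_initial. Qed.

Lemma loop_continuous (p : loop_space R x) : continuous (p : I -> X).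
Proof. exact: cts_fun. Qed.

Lemma loop_eval_continuous (T : topologicalType) (f : T -> loop_space R x) :
  continuous f -> continuous (fun z : T * I => f z.1 z.2).
Proof.
move=> cf; rewrite (_ : (fun z => _) = uncurry (fun c => f c : I -> X)).
  apply: continuous_uncurry.
  - exact: unit_interval_locally_compact.
  - exact: unit_interval_hausdorff.
  - exact: (continuous_compose loop_fun_continuous cf).
  - by move=> c; exact: loop_continuous.
by apply/funext => -[].
Qed.

(** Applying [K] at time [t] to every point of a loop gives a loop again, since [K] keeps [x]
    fixed. *)
Lemma loop_space_nullhomotopic (K : X * I -> X) (n : nat)
    (f : spheroid R (constant_loop R x) n) :
  continuous K -> (forall y, K (y, I0 R) = y) -> (forall y, K (y, I1 R) = x) ->
  (forall t, K (x, t) = x) ->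
  spheroid_homotopic f (constant_spheroid R (constant_loop R x) n).
Proof.
move=> cK K0 K1 Kx; case: f => f [cf fb].
have cE := loop_eval_continuous cf.
(* The loop parameter comes last, so that currying leaves the cube and the homotopy time as
   parameters of a family of paths. *)
pose E (z : (cube R n * I) * I) := K (f z.1.1 z.2, z.1.2).
have cEE : continuous E.
  apply: (continuous_compose cK); apply: continuous_pairing.
    apply: (continuous_compose (f := fun z => (z.1.1, z.2)) cE).
    apply: continuous_pairing; last exact: snd_continuous.
    by apply: continuous_compose; exact: fst_continuous.
  by apply: continuous_compose; [exact: snd_continuous|exact: fst_continuous].
have [cH cH'] := continuous_curry cEE.
have H0 z : curry E z zero = x by rewrite /curry /E /= path_zero Kx.
have H1 z : curry E z one = x by rewrite /curry /E /= path_one Kx.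
pose H z : loop_space R x := mk_path (cH' z) (H0 z) (H1 z).
exists H; split=> /=.
- apply: continuous_to_loop_space; exact: cH.
- by move=> c; apply/path_eqP => s; rewrite /= /mk_path /curry /E /= K0.
- by move=> c; apply/path_eqP => s; rewrite /= /mk_path /curry /E /= K1.
- move=> c t cb; apply/path_eqP => s.
  by rewrite /= /mk_path /curry /E /= fb // Kx.
Qed.

End LoopSpace.

(** * Joins of simplices with a point *)

Section Join.
Variables (R : realType) (q : nat).
Local Notation I := (unit_interval R).
Local Notation Delta n := (set_type (simplex R n)).

Lemma unit_interval_itv (l : I) : 0 <= set_val l <= 1.
Proof. by have /set_mem := svalP l; rewrite /= in_itv. Qed.

Definition join_coord (t : 'I_q.+1 -> R) (l : R) (j : 'I_q.+2) : R :=
  if (q < j)%N then l else (1 - l) * t (last_degeneracy q j).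

Lemma join_coord_face t l (j : 'I_q.+1) :
  join_coord t l (last_face q j) = (1 - l) * t j.
Proof.
rewrite /join_coord last_degeneracy_face ifF //.
by apply/negbTE; rewrite -leqNgt; exact: (leq_ord j).
Qed.

Lemma join_coord_last t l : join_coord t l ord_max = l.
Proof. by rewrite /join_coord /= ltnSn. Qed.

Lemma join_in (t : Delta q) (l : I) :
  (join_coord (set_val t) (set_val l) : prod_topology (fun=> R))
    \in simplex R q.+1.
Proof.
have [t0 t1] : simplex R q (set_val t) := set_mem (svalP t).
have /andP[l0 l1] := unit_interval_itv l.
rewrite inE; split=> [j|].
  by rewrite /join_coord; case: ifP => // _; rewrite mulr_ge0 ?subr_ge0.
rewrite big_ord_recr /= join_coord_last.
under eq_bigr do rewrite join_coord_face.
by rewrite -big_distrr /= t1 mulr1 subrK.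
Qed.

(* The point [(1 - l) t + l e] of the join of a simplex with a new last vertex
   [e]. *)
Definition join (t : Delta q) (l : I) : Delta q.+1 :=
  exist (fun u => u \in simplex R q.+1) _ (join_in t l).

Lemma joinE (t : Delta q) (l : I) :
  set_val (join t l) = join_coord (set_val t) (set_val l).
Proof. by []. Qed.

Lemma join_continuous : continuous (fun z : Delta q * I => join z.1 z.2).
Proof.
apply: continuous_to_set_type; apply: continuous_to_prod => j.
have cl : continuous (fun z : Delta q * I => set_val z.2).
  apply: continuous_compose (@snd_continuous _ _).
  exact: (@initial_continuous I R set_val).
have ct : continuous (fun z : Delta q * I => set_val z.1 (last_degeneracy q j)).
  apply: (continuous_compose (g := fun u : Delta q => set_val u _) _
    (@fst_continuous _ _)).
  apply: (@continuous_compose (Delta q) (prod_topology (fun _ : 'I_q.+1 => R)) R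
    (fun u => u (last_degeneracy q j)) set_val); last exact: initial_continuous.
  exact: (@proj_continuous 'I_q.+1 (fun=> R)).
have cl' : continuous (fun z : Delta q * I => 1 - set_val z.2).
  by move=> z; apply: cvgB; [exact: cvg_cst|exact: cl].
suff: continuous (fun z : Delta q * I =>
    join_coord (set_val z.1) (set_val z.2) j) by [].
rewrite /join_coord; case: (q < j)%N; first exact: cl.
by move=> z; exact: cvgM (cl' z) (ct z).
Qed.

End Join.

(** * Affine maps between simplices and their joins *)

Section SimplexImages.
Variable R : realType.
Local Notation Delta n := (set_type (simplex R n)).

Lemma simplex_image_id p (s : Delta p) : simplex_image (simplex_id p) s s.
Proof. by move=> j; rewrite /= big_pred1_eq. Qed.

Lemma simplex_image_to_point p (s : Delta p) :
  simplex_image (to_point p) s (point_simplex0 R).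
Proof.
move=> j; have [_ s1] : simplex R p (set_val s) := set_mem (svalP s).
by rewrite (eq_bigl xpredT) => [|i]; [exact: esym|rewrite (ord1 j)].
Qed.

Lemma ord_last_face q (j : 'I_q.+2) :
  j = ord_max \/ exists i, j = last_face q i.
Proof.
case: (unliftP ord_max j) => [i ->|->]; [right|by left].
by exists i; apply: ord_inj; rewrite lift_max.
Qed.

Lemma last_face_neq_max q (i : 'I_q.+1) : (last_face q i == ord_max) = false.
Proof. by rewrite -val_eqE /= ltn_eqF // ltn_ord. Qed.

(** The fibre of [cone_map ph] over the added vertex is the added vertex alone, and over an old
    vertex it is the fibre of [ph]; the factor [1 - l] comes out of the latter sums. *)
Lemma simplex_image_join p q (ph : simplex_map p q) (t : Delta p)
    (t1 : Delta q) l :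
  simplex_image ph t t1 -> simplex_image (cone_map ph) (join t l) (join t1 l).
Proof.
move=> tt1 j.
have cE (i : 'I_p.+1) :
    cone_map ph (widen_ord (leqnSn p.+1) i) = last_face q (ph i).
  rewrite /cone_map /= ifF.
    by congr (widen_ord _ (ph _)); exact: last_degeneracy_face.
  by apply/negbTE; rewrite -leqNgt; exact: (leq_ord i).
have cM : cone_map ph ord_max = ord_max by rewrite /cone_map /= ltnSn.
rewrite [RHS]big_mkcond [RHS]big_ord_recr cM !joinE join_coord_last.
under eq_bigr do rewrite cE (join_coord_face _ _ _).
have [->|[k ->]] := ord_last_face j.
  rewrite eqxx join_coord_last big1 /= ?add0r // => i _.
  by rewrite last_face_neq_max.
rewrite eq_sym last_face_neq_max [RHS]/= addr0 join_coord_face tt1.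
by rewrite big_distrr /= [LHS]big_mkcond.
Qed.

Lemma simplex_image_last_face q (t : Delta q) :
  simplex_image (last_face q) t (join t (I0 R)).
Proof.
move=> j; rewrite joinE; have [->|[k ->]] := ord_last_face j.
  by rewrite join_coord_last big_pred0 // => i; exact: last_face_neq_max.
by rewrite join_coord_face subr0 mul1r (eq_bigl (pred1 k)) ?big_pred1_eq.
Qed.

Lemma simplex_image_last_vertex q (t : Delta q) :
  simplex_image (last_vertex q.+1) (point_simplex0 R) (join t (I1 R)).
Proof.
move=> j; rewrite joinE big_mkcond big_ord1; have [->|[k ->]] := ord_last_face j.
  by rewrite join_coord_last eqxx.
by rewrite join_coord_face subrr mul0r eq_sym last_face_neq_max.
Qed.

End SimplexImages.

(** * Contraction of the realization along an extra degeneracy *)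

Section Contraction.
Variables (R : realType) (B : bisimplicial_set) (base : B 0 0).
Variable ext : forall p q, B p q -> B p q.+1.
Hypothesis ext_face : forall p p' q q' (th : simplex_map p' p)
  (ph : simplex_map q' q) (x : B p q),
  ext (face th ph x) = face th (cone_map ph) (ext x).
Hypothesis ext_last : forall p q (x : B p q),
  face (simplex_id p) (last_face q) (ext x) = x.
Hypothesis ext_vertex : forall p q (x : B p q),
  face (simplex_id p) (last_vertex q.+1) (ext x) =
  face (to_point p) (simplex_id 0) base.
Hypothesis ext_base : ext base = face (simplex_id 0) (to_point 1) base.

Local Notation I := (unit_interval R).
Local Notation X := (realization R B).
Local Notation pt := (point_simplex0 R).

Let basepoint : X := \pi_X (mk_cell base pt pt).

Lemma pi_glued (u v : cells R B) :
  clos_refl_sym_trans _ (@glue R B) u v -> \pi_X u = \pi_X v.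
Proof. by move=> uv; apply/(@eqquotP _ _ {eq_quot glued_rel R B})/asboolP. Qed.

Lemma glued_pi (u v : cells R B) :
  \pi_X u = \pi_X v -> clos_refl_sym_trans _ (@glue R B) u v.
Proof. by move=> /(@eqquotP _ _ {eq_quot glued_rel R B})/asboolP. Qed.

Lemma pi_face p p' q q' (th : simplex_map p' p) (ph : simplex_map q' q)
    (x : B p q) s s1 t t1 :
  simplex_image th s s1 -> simplex_image ph t t1 ->
  \pi_X (mk_cell (face th ph x) s t) = \pi_X (mk_cell x s1 t1).
Proof. by move=> ss tt; apply: pi_glued; apply: rst_step; exact: Glue. Qed.

(** The straight path in the extended cell from a point of the face opposite the added vertex to
    that vertex. *)
Definition contract_cell (b : cell_index B)
    (st : set_type (simplex R (projT1 b).1) * set_type (simplex R (projT1 b).2))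
    (l : I) : X :=
  \pi_X (mk_cell (ext (projT2 b)) st.1 (join st.2 l)).

Definition contract_cells : cells R B -> {compact-open, I -> X} :=
  fun c => contract_cell (projT2 c).

Lemma contract_cell_continuous (b : cell_index B) :
  continuous (fun z => @contract_cell b z.1 z.2).
Proof.
apply: (continuous_compose (@pi_continuous _ {eq_quot glued_rel R B})).
apply: (continuous_compose
  (@existT_continuous _ _ (existT _ (_, _) _ : cell_index B))).
apply: continuous_pairing.
  by apply: continuous_compose; exact: fst_continuous.
apply: (continuous_compose (f := fun z => (z.1.2, z.2)) (@join_continuous R _)).
apply: continuous_pairing; last exact: snd_continuous.
by apply: continuous_compose; [exact: snd_continuous|exact: fst_continuous].
Qed.

Lemma contract_cells_continuous : continuous contract_cells.
Proof.
apply: sigT_continuous => b.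
exact: (continuous_curry (@contract_cell_continuous b)).1.
Qed.

Lemma contract_cells_continuous_at c : continuous (contract_cells c : I -> X).
Proof.
by case: c => b st; apply: (continuous_curry (@contract_cell_continuous b)).2.
Qed.

Lemma contract_cells_glue (u v : cells R B) :
  glue u v -> contract_cells u = contract_cells v.
Proof.
case=> p p' q q' th ph x s s1 t t1 ss tt; apply/funext => l.
rewrite /contract_cells /contract_cell /= ext_face.
by apply: pi_face => //; exact: simplex_image_join.
Qed.

(** A representative is chosen here; [contractionE] shows that the choice does not matter. *)
Definition contraction (z : X * I) : X := contract_cells (repr z.1) z.2.

Lemma contract_cells_pi (u v : cells R B) :
  \pi_X u = \pi_X v -> contract_cells u = contract_cells v.
Proof.
move=> /glued_pi; elim=> [{}u {}v|//|{}u {}v _ ->//|{}u {}v w _ -> _ ->//].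
exact: contract_cells_glue.
Qed.

Lemma contractionE u l : contraction (\pi_X u, l) = contract_cells u l.
Proof.
by rewrite /contraction /=; congr (_ l); apply: contract_cells_pi; exact: reprK.
Qed.

Lemma contraction_continuous : continuous contraction.
Proof.
rewrite (_ : contraction = uncurry (contract_cells \o (repr : X -> cells R B))).
  apply: continuous_uncurry.
  - exact: unit_interval_locally_compact.
  - exact: unit_interval_hausdorff.
  (* The composite with [repr] is continuous by the quotient topology, because [contract_cells]
     takes equal values on glued points. *)
  - apply: (@repr_comp_continuous _ {eq_quot glued_rel R B}
      {compact-open, I -> X}); first exact: contract_cells_continuous.
    by move=> u v /eqP uv; apply/eqP; exact: contract_cells_pi.
  - by move=> y; exact: contract_cells_continuous_at.
by apply/funext => -[].
Qed.

Lemma contraction0 y : contraction (y, I0 R) = y.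
Proof.
rewrite -[y]reprK contractionE; case: (repr y) => -[[p q] x] [s t].
rewrite /contract_cells /contract_cell /=.
(* At time 0 the added vertex has weight zero: the point lies on the last face, where [ext x]
   restricts to [x]. *)
rewrite -(@pi_face _ _ _ _ (simplex_id p) (last_face q) _ s s t).
- by rewrite ext_last.
- exact: simplex_image_id.
- exact: simplex_image_last_face.
Qed.

Lemma contraction1 y : contraction (y, I1 R) = basepoint.
Proof.
rewrite -[y]reprK contractionE; case: (repr y) => -[[p q] x] [s t].
rewrite /contract_cells /contract_cell /=.
(* At time 1 the second coordinate is the added vertex; the face of [ext x] there is degenerate on
   [base], so the first coordinate collapses too. *)
rewrite -(@pi_face _ _ _ _ (simplex_id p) (last_vertex q.+1) _ s s pt).
- rewrite ext_vertex; apply: pi_face; first exact: simplex_image_to_point.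
  exact: simplex_image_id.
- exact: simplex_image_id.
- exact: simplex_image_last_vertex.
Qed.

(** As [ext base] is a degeneracy of [base], the whole path collapses to the base point. *)
Lemma contraction_base l : contraction (basepoint, l) = basepoint.
Proof.
rewrite contractionE /contract_cells /contract_cell /= ext_base.
apply: pi_face; first exact: simplex_image_id.
exact: simplex_image_to_point.
Qed.

End Contraction.

(** * Vanishing of the K-groups *)

Lemma K_group_trivial (R : realType) (W : waldhausen_category) (n : nat) :
  (forall (a b : W) (f : hom a b), wcof W f) ->
  K_group R W n = [set K_zero R W n].
Proof.
move=> call; apply: homotopy_group_trivial => f.
(* The extra degeneracy [extend call] contracts the realization while fixing the base point, as
   required for acting on loops. *)
pose K := @contraction R (wS W) (extend call).
apply: (@loop_space_nullhomotopic _ _ _ K).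
- by apply: contraction_continuous => *; exact: extend_face.
- by move=> y; apply: contraction0 => *;
    [exact: extend_face|exact: face_extend_last].
- by move=> y; apply: contraction1 => *;
    [exact: extend_face|exact: face_extend_vertex].
- by move=> l; apply: contraction_base => *;
    [exact: extend_face|exact: extend_base].
Qed.

Theorem theorem4p7 (R : realType) (C : category) (M : model_structure C)
  (C_complete : finitely_complete C) (C_cocomplete : finitely_cocomplete C)
  (M_local : bousfield_localization (discrete_model C) M \/
             bousfield_colocalization (discrete_model C) M)
  (C_pointed : pointed_category C) (z : C) (z_initial : is_initial z) :
  exists W_ok : is_waldhausen (cofibrant_objects M z_initial),
  forall n : nat,
    K_group R (WaldhausenCategory W_ok) n = [set K_zero R (WaldhausenCategory W_ok) n].
Proof.
have cof_all := discrete_local_cofibrant_cof C_cocomplete M_local.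
have W_ok : is_waldhausen (cofibrant_objects M z_initial).
  apply: cofibrant_objects_waldhausen => // [x y f|x y e b f p].
    exact: cof_all.
  exact: (discrete_local_unique_lifts C_cocomplete M_local).
exists W_ok => n; apply: K_group_trivial => a b f.
exact: (cof_all _ _ _ _ z_initial (svalP a) (svalP b)).
Qed.
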